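(* For $r,s\in\mathbb N$ with $m=\max(r,s)\geq1$, let $1\leq\lambda_1<\cdots<\lambda_s\leq r$ when $r\geq s$ and $1\leq\sigma_1<\cdots<\sigma_r\leq s$ when $r\leq s$. Let $R=\mathbb Q(b_1,\dots,b_s)[a_1,\dots,a_r]$ for $a_1,\dots,a_r,b_1,\dots,b_s$ such that, for all $1\leq i\leq r$, $1\leq j\leq s$ and $n\in\mathbb N$: (i) $a_i+n\neq0$ and $b_j+n\neq0$; (ii) when $r\geq s$: $b_j-a_i+n\neq0$ if $i\leq\lambda_j$, and $b_j-a_i+1+n\neq0$ if $i\geq\lambda_j+1$; (iii) when $r\leq s$: $b_j-a_i+n\neq0$ if $\sigma_i\leq j$, and $b_j-a_i+1+n\neq0$ if $\sigma_i\geq j+1$. Let $(v_0,\dots,v_{m-1})$ be the vector of linear functionals acting on $R[x]$ with moments $$v_k[x^n]=\frac{\left(a_1^{(k)}\right)_n\cdots\left(a_r^{(k)}\right)_n}{\left(b_1^{(k)}\right)_n\cdots\left(b_s^{(k)}\right)_n}\qquad\text{for }n\in\mathbb N\text{ and }0\leq k\leq m-1,$$ where, for $0\leq k\leq m-1$: when $r\geq s$, $a_i^{(k)}=a_i+1$ if $1\leq i\leq k$ and $a_i^{(k)}=a_i$ if $k+1\leq i\leq r$, and $b_j^{(k)}=b_j+1$ if $1\leq\lambda_j\leq k$ and $b_j^{(k)}=b_j$ if $k+1\leq\lambda_j\leq r$; when $r\leq s$, $a_i^{(k)}=a_i+1$ if $1\leq\sigma_i\leq k$ and $a_i^{(k)}=a_i$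 if $k+1\leq\sigma_i\leq s$, and $b_j^{(k)}=b_j+1$ if $1\leq j\leq k$ and $b_j^{(k)}=b_j$ if $k+1\leq j\leq s$. Then, the $m$-orthogonal polynomial sequence $(P_n(x))_{n\in\mathbb N}$ with respect to $(v_0,\dots,v_{m-1})$ is given by $$P_n(x)=\frac{(-1)^n(a_1)_n\cdots(a_r)_n}{\left(b_1^{(n-1)}\right)_n\cdots\left(b_s^{(n-1)}\right)_n}\;{}_{s+1}F_r\left(\left.\begin{matrix}-n,b_1^{(n-1)},\dots,b_s^{(n-1)}\\ a_1,\dots,a_r\end{matrix}\,\right|\,x\right),$$ with $$b_j^{(n-1)}=b_j+\left\lceil\frac{n-\lambda_j}{r}\right\rceil\text{ when }r\geq s\qquad\text{or}\qquad b_j^{(n-1)}=b_j+\left\lceil\frac{n-j}{s}\right\rceil\text{ when }r\leq s.$$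
   Context: $\mathbb N=\{0,1,2,\dots\}$; $(z)_0=1$, $(z)_n=z(z+1)\cdots(z+n-1)$ for $n\ge1$; ${}_pF_q\left(\left.\begin{matrix}c_1,\dots,c_p\\ d_1,\dots,d_q\end{matrix}\,\right|\,x\right)=\sum_{n\ge0}\frac{(c_1)_n\cdots(c_p)_n}{(d_1)_n\cdots(d_q)_n}\frac{x^n}{n!}$ (here terminating). The parameters $a_i,b_j$ are indeterminates, or elements of a field of characteristic zero (e.g. real or complex numbers) satisfying the stated non-vanishing conditions, in which case $R$ is the subring generated by $\mathbb Q(b_1,\dots,b_s)$ and the $a_i$. A linear functional on $R[x]$ is an $R$-linear map $u:R[x]\to R$, with values written $u[f]$. For $d\ge 1$, a sequence $(P_n(x))_{n\in\mathbb N}$ of monic polynomials with $\deg P_n=n$ is $d$-orthogonal with respect to $(u_0,\dots,u_{d-1})$ if, for all $j\in\{0,\dots,d-1\}$ and $k,n\in\mathbb N$, $u_j[x^kP_n]\neq0$ if $n=dk+j$ and $u_j[x^kP_n]=0$ if $n\geq dk+j+1$. *)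

(* Defs.v *)
From HB Require Import structures.
From mathcomp Require Import all_boot all_order all_algebra.
From mathcomp Require Import boolp.

Set Implicit Arguments.
Unset Strict Implicit.
Unset Printing Implicit Defensive.

Import GRing.Theory.
Local Open Scope ring_scope.

Definition poch (K : fieldType) (z : K) (n : nat) : K :=
  \prod_(i < n) (z + i%:R).

Section Hypergeometric.
Variable K : fieldType.

(* Coefficient of x^n in the series pFq(c; d | x). *)
Definition pFq_coef (c d : seq K) (n : nat) : K :=
  (\prod_(z <- c) poch z n) / (\prod_(z <- d) poch z n) / n`!%:R.

(* The terminating series pFq(c; d | x): when -N is one of the numerator
   parameters, all coefficients of degree > N vanish (see coef_pFq). *)
Definition pFq (N : nat) (c d : seq K) : {poly K} :=
  \poly_(n < N.+1) pFq_coef c d n.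

Lemma coef_pFq (N : nat) (c d : seq K) (n : nat) :
  - N%:R \in c -> (pFq N c d)`_n = pFq_coef c d n.
Proof.
move=> cN; rewrite coef_poly; case: ltnP => // ltNn.
rewrite /pFq_coef (perm_big _ (perm_to_rem cN)) big_cons /poch.
by rewrite (bigD1 (Ordinal ltNn)) //= addNr !mul0r.
Qed.

End Hypergeometric.

Section ParameterRing.
Variables (K : fieldType) (r s : nat) (a : 'I_r -> K) (b : 'I_s -> K).

(* Q(b_1, ..., b_s): the least subfield of K containing the b_j (it contains
   the prime field, which is Q in characteristic zero). *)
Definition in_Qb (x : K) : Prop :=
  forall S : {pred K}, GRing.divring_closed S ->
    (forall j, b j \in S) -> x \in S.

(* R = Q(b_1, ..., b_s)[a_1, ..., a_r]: the subring of K generated by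
   Q(b_1, ..., b_s) and the a_i. *)
Definition in_Qba (x : K) : Prop :=
  forall S : {pred K}, GRing.subring_closed S ->
    (forall y, in_Qb y -> y \in S) -> (forall i, a i \in S) -> x \in S.

Definition Qba_pred : {pred K} := fun x => `[< in_Qba x >].

Lemma Qba_subring_closed : GRing.subring_closed Qba_pred.
Proof.
split.
- by apply/asboolP => S [].
- move=> x y /asboolP Rx /asboolP Ry; apply/asboolP => S closedS Sb Sa.
  by have [_ SB _] := closedS; apply: SB; [apply: Rx | apply: Ry].
- move=> x y /asboolP Rx /asboolP Ry; apply/asboolP => S closedS Sb Sa.
  by have [_ _ SM] := closedS; apply: SM; [apply: Rx | apply: Ry].
Qed.

HB.instance Definition _ :=
  GRing.isSubringClosed.Build K Qba_pred Qba_subring_closed.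

Record Qba : Type := MkQba { Qba_val : K; Qba_valP : Qba_val \in Qba_pred }.

HB.instance Definition _ := [isSub for Qba_val].
HB.instance Definition _ := [Choice of Qba by <:].
HB.instance Definition _ := [SubChoice_isSubComNzRing of Qba by <:].

End ParameterRing.

Section DOrthogonality.
Variable R : comNzRingType.

Definition monic_poly_seq (P : nat -> {poly R}) : Prop :=
  forall n, P n \is monic /\ size (P n) = n.+1.

Definition d_orthogonal (d : nat) (u : 'I_d -> {scalar {poly R}})
    (P : nat -> {poly R}) : Prop :=
  monic_poly_seq P /\
  forall (j : 'I_d) (k n : nat),
    ((n = d * k + j)%N -> u j ('X^k * P n) != 0) /\
    ((n >= d * k + j + 1)%N -> u j ('X^k * P n) = 0).

(* Any sequence of elements of R is the moment sequence of a functional. *)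
Lemma moment_functional (mu : nat -> R) :
  exists v : {scalar {poly R}}, forall n, v 'X^n = mu n.
Proof.
pose f (p : {poly R}) : R := \sum_(i < size p) p`_i * mu i.
have fE N (p : {poly R}) : (size p <= N)%N -> f p = \sum_(i < N) p`_i * mu i.
  move=> leN; rewrite /f (big_ord_widen N (fun i => p`_i * mu i)) //.
  rewrite [RHS](bigID (fun i : 'I_N => (i < size p)%N)) /=.
  rewrite [X in _ = _ + X]big1 ?addr0 // => i.
  by rewrite -leqNgt => /(nth_default 0) ->; rewrite mul0r.
have f_lin : scalar f.
  move=> c p q; set N := maxn (size p) (size q).
  have le1 : (size p <= N)%N by apply: leq_maxl.
  have le2 : (size q <= N)%N by apply: leq_maxr.
  have le3 : (size (c *: p + q)%R <= N)%N.
    rewrite (leq_trans (size_polyD _ _)) // geq_max le2 andbT.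
    exact: leq_trans (size_scale_leq _ _) le1.
  rewrite (fE N _ le1) (fE N _ le2) (fE N _ le3) big_distrr -big_split /=.
  by apply: eq_bigr => i _; rewrite coefD coefZ mulrDl mulrA.
pose fM := GRing.isLinear.Build R {poly R} R *%R f f_lin.
pose fL : {scalar {poly R}} := HB.pack f fM.
exists fL => n; rewrite [LHS](fE n.+1) ?size_polyXn // big_ord_recr /=.
rewrite coefXn eqxx mul1r big1 ?add0r // => i _.
by rewrite coefXn ltn_eqF // mul0r.
Qed.

End DOrthogonality.

(* The indices of the parameters are 0-based: a i is a_{i+1} and b j is b_{j+1},
   while the values lam j = lambda_{j+1} and sig i = sigma_{i+1} are the 1-based
   ones.  lam is used for s <= r and sig for r <= s; for r = s both families are
   forced to be 1, ..., r and the two cases coincide. *)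
Section Shifts.
Variables (K : fieldType) (r s : nat) (a : 'I_r -> K) (b : 'I_s -> K).
Variables (lam : 'I_s -> nat) (sig : 'I_r -> nat).

(* a_{i+1}^{(k)} and b_{j+1}^{(k)}, for 0 <= k <= max(r,s) - 1 *)
Definition a_shift (k : nat) (i : 'I_r) : K :=
  if (s <= r)%N then (if (i.+1 <= k)%N then a i + 1 else a i)
  else (if (sig i <= k)%N then a i + 1 else a i).

Definition b_shift (k : nat) (j : 'I_s) : K :=
  if (s <= r)%N then (if (lam j <= k)%N then b j + 1 else b j)
  else (if (j.+1 <= k)%N then b j + 1 else b j).

(* b_{j+1}^{(n-1)}, for n >= 0 *)
Definition b_ceil (n : nat) (j : 'I_s) : K :=
  if (s <= r)%N then
    b j + (Num.ceil ((n%:R - (lam j)%:R) / r%:R : rat))%:~R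
  else
    b j + (Num.ceil ((n%:R - (j.+1)%:R) / s%:R : rat))%:~R.

Definition moment (k n : nat) : K :=
  (\prod_(i < r) poch (a_shift k i) n) / (\prod_(j < s) poch (b_shift k j) n).

Definition explicit_P (n : nat) : {poly K} :=
  ((-1) ^+ n * (\prod_(i < r) poch (a i) n)
     / (\prod_(j < s) poch (b_ceil n j) n))
  *: pFq n (- n%:R :: [seq b_ceil n j | j : 'I_s]) [seq a i | i : 'I_r].

Lemma Qba_moment (k n : nat) : moment k n \in Qba_pred a b.
Proof.
have Rb x : in_Qb b x -> x \in Qba_pred a b.
  by move=> bx; apply/asboolP => S _ Sb _; apply: Sb.
rewrite /moment rpredM //.
- apply: rpred_prod => i _; apply: rpred_prod => l _.
  have Ra : a i \in Qba_pred a b by apply/asboolP => S _ _; apply.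
  by rewrite rpredD ?rpred_nat // /a_shift; do !case: ifP => _; rewrite ?rpredD ?rpred1.
- apply: Rb => S divS Sb; have [S1 SB SV] := divS.
  pose inst := GRing.isDivringClosed.Build K S divS.
  pose S' : divringClosed K := HB.pack S inst.
  rewrite -[S]/(S' : {pred K}) in Sb *; rewrite rpredV.
  apply: rpred_prod => j _; apply: rpred_prod => l _.
  by rewrite rpredD ?rpred_nat // /b_shift; do !case: ifP => _; rewrite ?rpredD ?rpred1 ?Sb.
Qed.

End Shifts.

(* Main.v *)
(** For [l <= n] the moment of order [k + l] of [v_j] times the coefficient of
    [x^l] in [P_n] is, up to a constant, [(-1)^l C(n, l) F(l)], where the quotient
    [(a^(j))_(k+l) / (a)_l] contributes a polynomial in [l] and
    [(b^(n-1))_l / (b^(j))_(k+l)] contributes a polynomial as soon as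
    [b^(n-1) - b^(j) >= k].  When [n > m k + j] this holds for every denominator
    parameter and, by Hermite's identity [sum_t floor((n + t) / m) = n], the total
    degree of [F] is less than [n], so the [n]-th finite difference vanishes.
    When [n = m k + j] at most one denominator parameter falls short, by exactly
    one.  If none does, [F] has degree exactly [n].  Otherwise
    [F(l) = f(l) / (l + x)] with [deg f <= n], and the sum is
    [f(-x) n! / (x)_(n+1)], which the conditions on [b_j - a_i] make nonzero. *)
From HB Require Import structures.
Require Import Defs.
From mathcomp Require Import all_boot all_order all_algebra.
From mathcomp Require Import boolp ring zify.

Import GRing.Theory Num.Theory.
Local Open Scope ring_scope.

(** * Pochhammer symbols and their polynomial form *)

Lemma poch0 {K : fieldType} (z : K) : poch z 0 = 1.
Proof. by rewrite /poch big_ord0. Qed.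

Lemma pochS {K : fieldType} (z : K) (n : nat) :
  poch z n.+1 = poch z n * (z + n%:R).
Proof. by rewrite /poch big_ord_recr. Qed.

Lemma pochD {K : fieldType} (z : K) (m n : nat) :
  poch z (m + n) = poch z m * poch (z + m%:R) n.
Proof.
elim: n => [|n IHn]; first by rewrite addn0 poch0 mulr1.
by rewrite addnS !pochS IHn natrD addrA mulrA.
Qed.

Lemma poch_neq0 {K : fieldType} (z : K) (n : nat) :
  (forall i : nat, z + i%:R != 0) -> poch z n != 0.
Proof. by move=> z_neq0; apply/prodf_neq0 => i _. Qed.

(** Turns the factor [(-n)_l / l!] of the hypergeometric series into the signed binomial of an
    [n]-th finite difference. *)
Lemma poch_oppn {K : fieldType} (n l : nat) :
  (l <= n)%N -> poch (- n%:R : K) l = (-1) ^+ l * ('C(n, l) * l`!)%:R.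
Proof.
elim: l => [|l IHl] ln; first by rewrite poch0 bin0 mul1r.
rewrite pochS IHl; last exact: ltnW.
have -> : ('C(n, l.+1) * l.+1`! = (n - l) * ('C(n, l) * l`!))%N.
  by rewrite factS mulnA [('C(_, _.+1) * _)%N]mulnC mul_bin_left mulnA.
by rewrite !natrM natrB ?(ltnW ln) // exprS; ring.
Qed.

(** The polynomial [(z + X)_n], written through its roots so that facts on products of monic linear
    factors apply. *)
Definition pochp {K : fieldType} (z : K) (n : nat) : {poly K} :=
  \prod_(i < n) ('X - (- (z + i%:R))%:P).

Lemma horner_pochp {K : fieldType} (z x : K) (n : nat) :
  (pochp z n).[x] = poch (z + x) n.
Proof.
rewrite /pochp horner_prod; apply: eq_bigr => i _.
by rewrite hornerXsubC opprK addrCA addrA.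
Qed.

Lemma pochp_monic {K : fieldType} (z : K) (n : nat) : pochp z n \is monic.
Proof. exact: monic_prod_XsubC. Qed.

Lemma size_prod_pochp {K : fieldType} (I : finType) (z : I -> K) (d : I -> nat) :
  size (\prod_i pochp (z i) (d i)) = (\sum_i d i).+1.
Proof.
(* Monicity is carried along because it makes degrees add under products. *)
pose Q (p : {poly K}) e := (p \is monic) /\ size p = e.+1.
suff [] : Q (\prod_i pochp (z i) (d i)) (\sum_i d i)%N by [].
apply: (big_ind2 Q) => [|p e q f [mp sp] [mq sq]|i _].
- by rewrite /Q monic1 size_poly1.
- by split; rewrite ?monicMl // size_Mmonic ?monic_neq0 // sp sq addSn addnS.
- by split; rewrite ?pochp_monic // /pochp size_prod_XsubC /index_enum -enumT size_enum_ord.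
Qed.

(** * Finite differences and partial fractions *)

Lemma alt_sum_bin_eq0 {K : fieldType} (n : nat) :
  \sum_(l < n.+2) (-1) ^+ l * 'C(n.+1, l)%:R = 0 :> K.
Proof.
have := exprDn (1 : K) (-1) n.+1; rewrite subrr expr0n /= => /esym eq0.
by rewrite -[RHS]eq0; apply: eq_bigr => l _; rewrite expr1n mul1r mulr_natr.
Qed.

(** Induction, dividing [p - p(n+1)] by [X - (n+1)]: the constant contributes zero, and
    [(l - (n+1)) C(n+1, l) = -(n+1) C(n, l)] leaves an [n]-th difference of the quotient. *)
Lemma finite_difference {K : fieldType} (n : nat) (p : {poly K}) :
  (size p <= n.+1)%N ->
  \sum_(l < n.+1) (-1) ^+ l * 'C(n, l)%:R * p.[l%:R] = (-1) ^+ n * n`!%:R * p`_n.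
Proof.
elim: n p => [|n IHn] p sp.
  by rewrite big_ord1 /= (size1_polyC sp) hornerC coefC /=.
have [q pE] : exists q, p - (p.[n.+1%:R])%:P = q * ('X - (n.+1%:R)%:P).
  by apply/factor_theorem; rewrite rootE !hornerE subrr.
have sq : (size q <= n.+1)%N.
  have [->|q0] := eqVneq q 0; first by rewrite size_poly0.
  rewrite -ltnS; have := size_Mmonic q0 (monicXsubC (n.+1%:R : K)).
  rewrite -pE size_XsubC addn2 /= => <-.
  rewrite (leq_trans (size_polyD _ _)) // geq_max sp size_polyN.
  exact: leq_trans (size_polyC_leq1 _) _.
have pn : p`_n.+1 = q`_n.
  have /(congr1 (fun t : {poly K} => t`_n.+1)) := pE.
  rewrite coefB coefC subr0 => ->; rewrite mulrBr coefB coefMX coefMC /=.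
  by rewrite (nth_default 0 sq) mul0r subr0.
transitivity (\sum_(l < n.+2) ((-1) ^+ l * 'C(n.+1, l)%:R * p.[n.+1%:R]
   + (-1) ^+ l * 'C(n.+1, l)%:R * (q.[l%:R] * (l%:R - n.+1%:R)))).
  apply: eq_bigr => l _; rewrite -mulrDr; congr (_ * _).
  have /(congr1 (fun t => t.[l%:R])) := pE.
  by rewrite hornerM hornerXsubC hornerD hornerN hornerC => <-; rewrite addrC subrK.
rewrite big_split /= -mulr_suml alt_sum_bin_eq0 mul0r add0r.
rewrite big_ord_recr /= subrr !mulr0 addr0 pn.
transitivity (- n.+1%:R * \sum_(l < n.+1) (-1) ^+ l * 'C(n, l)%:R * q.[l%:R]).
  rewrite mulr_sumr; apply: eq_bigr => l _.
  have lE : (l <= n.+1)%N by rewrite ltnW.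
  have /(congr1 (fun x : nat => x%:R : K)) := mul_bin_down n.+1 l.
  rewrite !natrM natrB // => E.
  rewrite -[l%:R - _]opprB; transitivity
    (- ((-1) ^+ l * q.[l%:R]) * ((n.+1%:R - l%:R) * 'C(n.+1, l)%:R)); first by ring.
  by rewrite -E; ring.
by rewrite IHn // factS natrM exprS; ring.
Qed.

(** A partial fraction expansion. By Pascal's rule the sum [S_n(x)] satisfies
    [S_(n+1)(x) = S_n(x) - S_n(x + 1)]. *)
Lemma alt_sum_bin_inv {K : fieldType} (n : nat) (x : K) :
  (forall i : nat, x + i%:R != 0) ->
  \sum_(l < n.+1) (-1) ^+ l * 'C(n, l)%:R / (x + l%:R) = n`!%:R / poch x n.+1.
Proof.
elim: n x => [|n IHn] x x0.
  by rewrite big_ord1 pochS poch0 bin0 expr0 fact0 !mul1r.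
have x1 i : x + 1 + i%:R != 0 by rewrite -addrA -mulrS.
transitivity (\sum_(l < n.+1) (-1) ^+ l * 'C(n, l)%:R / (x + l%:R)
   - \sum_(l < n.+1) (-1) ^+ l * 'C(n, l)%:R / (x + 1 + l%:R)).
  pose G l : K := (-1) ^+ l * 'C(n, l)%:R / (x + l%:R).
  (* Padding with the zero term [C(n, n+1)] lets Pascal's rule apply term by term. *)
  have -> : \sum_(l < n.+1) (-1) ^+ l * 'C(n, l)%:R / (x + l%:R) =
      \sum_(l < n.+2) G l.
    by rewrite [RHS]big_ord_recr /= /G bin_small ?ltnSn // mulr0 mul0r addr0.
  rewrite !(big_ord_recl n.+1) /= /G !bin0 -addrA; congr (_ + _).
  rewrite -sumrB; apply: eq_bigr => l _; rewrite /bump /= add1n binS natrD exprS.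
  by rewrite -[x + 1 + _]addrA -mulrS; ring.
rewrite !IHn //.
have E1 : poch x n.+2 = x * poch (x + 1) n.+1 by rewrite -add1n pochD pochS poch0 addr0 mul1r.
have E2 : poch x n.+2 = poch x n.+1 * (x + n.+1%:R) by rewrite pochS.
have xn := x0 n.+1; have := x0 0%N; rewrite addr0 => xn0.
have p1 := @poch_neq0 _ _ n.+1 x0.
have -> : poch (x + 1) n.+1 = poch x n.+1 * (x + n.+1%:R) / x.
  by rewrite -E2 E1 mulrAC mulfV ?mul1r.
rewrite E2 factS natrM; field.
by rewrite -[1 + n%:R]mulrS xn p1.
Qed.

(* Dividing [f] by ['X + x] leaves the remainder [f.[- x]] and a quotient of
   degree less than [n], which is killed by the [n]-th difference. *)
Lemma finite_difference_pole {K : fieldType} (n : nat) (f : {poly K}) (x : K) :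
  (forall i : nat, x + i%:R != 0) -> (size f <= n.+1)%N ->
  \sum_(l < n.+1) (-1) ^+ l * 'C(n, l)%:R * (f.[l%:R] / (x + l%:R)) =
  f.[- x] * n`!%:R / poch x n.+1.
Proof.
move=> x0 sf.
have [q fE] : exists q, f - (f.[- x])%:P = q * ('X - (- x)%:P).
  by apply/factor_theorem; rewrite rootE !hornerE subrr.
have sq : (size q <= n)%N.
  have [->|q0] := eqVneq q 0; first by rewrite size_poly0.
  rewrite -ltnS; have := size_Mmonic q0 (monicXsubC (- x)).
  rewrite -fE size_XsubC addn2 /= => <-.
  rewrite (leq_trans (size_polyD _ _)) // geq_max sf size_polyN.
  exact: leq_trans (size_polyC_leq1 _) _.
transitivity (\sum_(l < n.+1) (f.[- x] * ((-1) ^+ l * 'C(n, l)%:R / (x + l%:R))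
   + (-1) ^+ l * 'C(n, l)%:R * q.[l%:R])).
  apply: eq_bigr => l _.
  have /(congr1 (fun t => t.[l%:R])) := fE.
  rewrite hornerM hornerXsubC hornerD hornerN hornerC opprK => /eqP.
  rewrite subr_eq => /eqP ->; have := x0 l => xl; field.
  by rewrite xl.
rewrite big_split /= -mulr_sumr alt_sum_bin_inv // finite_difference; last exact: leq_trans sq _.
by rewrite (nth_default 0 sq) mulr0 addr0 mulrA.
Qed.

(** * Sums of floors and sums over thresholds *)

(** Hermite's identity: raising [n] by one drops the first summand and appends that same value plus
    one. *)
Lemma sum_divn_shift (m n : nat) : (0 < m)%N -> (\sum_(i < m) (n + i) %/ m = n)%N.
Proof.
case: m => // m _; elim: n => [|n IHn].
  by rewrite big1 // => i _; rewrite add0n divn_small.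
have last_term : ((n.+1 + m) %/ m.+1 = (n + 0) %/ m.+1 + 1)%N.
  by rewrite addn0 addSnnS divnDr ?dvdnn // divnn.
rewrite big_ord_recr /= last_term -[in RHS]IHn [in RHS]big_ord_recl /=.
rewrite addnA addn1 addnC; congr (_ + _).+1; apply: eq_bigr => i _.
by rewrite /bump /= add1n addnS addSn.
Qed.

Lemma sum_divn_shift_rev (m n : nat) : (0 < m)%N ->
  (\sum_(t < m) (n + (m - t.+1)) %/ m = n)%N.
Proof.
move=> m0; rewrite -[RHS](sum_divn_shift m) // [RHS](reindex_inj rev_ord_inj).
by [].
Qed.

(** The values [f i] are distinct elements of [[1, m]], so the left side is a partial sum of natural
    numbers. *)
Lemma leq_sum_inj {I : finType} (m : nat) (f : I -> nat) (F : nat -> nat) :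
  injective f -> (forall i, 1 <= f i <= m)%N ->
  (\sum_i F (f i) <= \sum_(t < m) F t.+1)%N.
Proof.
move=> f_inj f_range.
have fP i : ((f i).-1 < m)%N by have := f_range i; lia.
pose g i := Ordinal (fP i).
have g_inj : injective g.
  move=> i i' /(congr1 val) /= E; apply: f_inj.
  by have := f_range i; have := f_range i'; lia.
have -> : (\sum_i F (f i) = \sum_(t in [set g i | i in predT]) F (t : 'I_m).+1)%N.
  rewrite big_imset /=; last by move=> i i' _ _; apply: g_inj.
  by apply: eq_bigr => i _; congr F; have := f_range i; lia.
by rewrite [leqRHS](bigID [in [set g i | i in predT]]) leq_addr.
Qed.

Lemma sum_leq_ord (m j : nat) : (\sum_(t < m) (t.+1 <= j) = minn m j)%N.
Proof. by elim: m => [|m IHm]; rewrite ?big_ord0 ?big_ord_recr /= ?IHm; lia. Qed.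

(** * Ratios of Pochhammer symbols as functions of the summation index *)

(** Split [(z)_(e+k+l)] after [e] factors and after [l] factors. *)
Lemma poch_ratio_num {K : fieldType} (z : K) (e k l : nat) :
  (forall i : nat, z + i%:R != 0) ->
  poch (z + e%:R) (k + l) / poch z l =
  (poch z e)^-1 * (pochp z (k + e)).[l%:R].
Proof.
move=> z0; have pe := @poch_neq0 _ _ e z0; have pl := @poch_neq0 _ _ l z0.
have E : poch z e * poch (z + e%:R) (k + l) = poch z l * poch (z + l%:R) (k + e).
  by rewrite -!pochD; congr (poch z _); lia.
rewrite horner_pochp; apply: (mulfI pe); rewrite mulrA E [RHS]mulrA mulfV // mul1r.
by rewrite mulrAC mulfV // mul1r.
Qed.

(** Split [(z)_(c+l)] after [c] factors and after [e], then after [k + l] more; [k + e <= c] ensures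
    that the last block exists. *)
Lemma poch_ratio_den {K : fieldType} (z : K) (e k l c : nat) :
  (forall i : nat, z + i%:R != 0) -> (k + e <= c)%N ->
  poch (z + c%:R) l / poch (z + e%:R) (k + l) =
  poch z e / poch z c * (pochp (z + (k + e)%:R) (c - (k + e))).[l%:R].
Proof.
move=> z0 le_c; have pe := @poch_neq0 _ _ e z0; have pc := @poch_neq0 _ _ c z0.
have pd : poch (z + e%:R) (k + l) != 0.
  by apply: poch_neq0 => i; rewrite -addrA -natrD.
have E : poch z c * poch (z + c%:R) l = poch z e * poch (z + e%:R) (k + l)
    * poch (z + (k + e)%:R + l%:R) (c - (k + e)).
  have -> : z + (k + e)%:R + l%:R = z + (e + (k + l))%:R.
    by rewrite -addrA -natrD; congr (z + _%:R); lia.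
  by rewrite -!pochD; congr (poch z _); lia.
apply: (mulfI pc); rewrite mulrA E horner_pochp; field.
by rewrite pc pd.
Qed.

(** Here [c] is one short, so a single linear factor survives in the denominator. *)
Lemma poch_ratio_pole {K : fieldType} (z : K) (e k l c : nat) :
  (forall i : nat, z + i%:R != 0) -> (c.+1 = k + e)%N ->
  poch (z + c%:R) l / poch (z + e%:R) (k + l) =
  poch z e / poch z c / (z + c%:R + l%:R).
Proof.
move=> z0 c_eq; have pe := @poch_neq0 _ _ e z0; have pc := @poch_neq0 _ _ c z0.
have pd : poch (z + e%:R) (k + l) != 0.
  by apply: poch_neq0 => i; rewrite -addrA -natrD.
have cl : z + c%:R + l%:R != 0 by rewrite -addrA -natrD.
have E : poch z c * poch (z + c%:R) l * (z + c%:R + l%:R) =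
    poch z e * poch (z + e%:R) (k + l).
  by rewrite -!pochD -addrA -natrD -pochS; congr (poch z _); lia.
apply: (mulfI pc); apply: (mulIf cl); apply: (mulIf pd).
transitivity (poch z c * poch (z + c%:R) l * (z + c%:R + l%:R)).
  by field.
by rewrite E; field; rewrite cl pc.
Qed.

(** * Arithmetic of the ceilings *)

(* For [n >= 1] and [1 <= t <= m] this is the ceiling of [(n - t) / m]; at
   [n = 0] it is [0] whereas the ceiling is [-1] for [t = m]. *)
Definition nceil (m n t : nat) : nat := ((n.-1 + (m - t)) %/ m)%N.

(** The dividend is at least [m k + j + (m - t)], which reaches [m (k + 1)] once [t <= j]. *)
Lemma leq_nceil (m n k j t : nat) : (1 <= t <= m)%N -> (m * k + j < n)%N ->
  (k + (t <= j) <= nceil m n t)%N.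
Proof.
move=> t_range lt_n; rewrite /nceil leq_divRL; last by lia.
by case: leqP => tj /=; nia.
Qed.

(* At [n = m k + j] exactly one threshold has a ceiling that is too small for
   the denominator to cancel. *)
Definition pole (m j : nat) : nat := if j is 0 then m else j.

Lemma nceil_pole (m k j t : nat) : (j < m)%N -> (0 < m * k + j)%N ->
  (1 <= t <= m)%N -> (nceil m (m * k + j) t + (t == pole m j) = k + (t <= j))%N.
Proof.
move=> jm n0 t_range; have m0 : (0 < m)%N by lia.
have div_eq x d : (m * d <= x)%N -> (x < m * d.+1)%N -> (x %/ m = d)%N.
  move=> le1 lt2; apply/eqP.
  by rewrite eqn_leq leq_divRL // -ltnS ltn_divLR // mulnC lt2 mulnC.
rewrite /nceil; case: j => [|j] /= in jm n0 *.
  case: eqVneq => [tm|ntm] /=.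
    (* With [j = 0], positivity of [m * k + j] forces [k >= 1], so [k.-1] is a true predecessor. *)
    by rewrite (div_eq _ k.-1); nia.
  by rewrite (div_eq _ k); nia.
case: eqVneq => [tm|ntm] /=.
  by rewrite (div_eq _ k); nia.
by rewrite (div_eq _ (k + (t <= j.+1))%N); case: leqP => tj /=; nia.
Qed.

(** For evaluating the numerator at the pole: [t] is the threshold of a numerator parameter and [u]
    the index of one of its factors. The bound matches the conditions on [b_j - a_i]. *)
Lemma leq_pole (m k j c t u : nat) :
  (j < m)%N -> (c.+1 = k + (pole m j <= j))%N -> (1 <= t <= m)%N ->
  (u < k + (t <= j))%N -> ((pole m j < t) + u <= c)%N.
Proof. by case: j => [|j] /=; lia. Qed.

(** * Vanishing and non-vanishing of the alternating sum *)

Section UnifiedShifts.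

(* [alpha] and [beta] are the thresholds at which the numerator and denominator
   parameters are raised: one of the two enumerates [1, ..., m], the other one
   is the family [sigma] or [lambda]. *)
Variables (K : fieldType) (r s m : nat).
Variables (alpha : 'I_r -> nat) (beta : 'I_s -> nat).
Variables (a : 'I_r -> K) (b : 'I_s -> K).
Hypothesis alpha_inj : injective alpha.
Hypothesis alpha_range : forall i, (1 <= alpha i <= m)%N.
Hypothesis beta_inj : injective beta.
Hypothesis beta_range : forall q, (1 <= beta q <= m)%N.
Hypothesis a_neq0 : forall i (n : nat), a i + n%:R != 0.
Hypothesis b_neq0 : forall q (n : nat), b q + n%:R != 0.

(* Up to a nonzero factor this is [v_j (x^k P_n)]. *)
Definition moment_sum (n k j : nat) : K :=
  \sum_(l < n.+1) (-1) ^+ l * 'C(n, l)%:R *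
    ((\prod_i (poch (a i + (alpha i <= j)%N%:R) (k + l) / poch (a i) l)) *
     (\prod_q (poch (b q + (nceil m n (beta q))%:R) l /
               poch (b q + (beta q <= j)%N%:R) (k + l)))).

Let num_const (j : nat) : K := \prod_i (poch (a i) (alpha i <= j)%N)^-1.

Let den_const (n j : nat) : K :=
  \prod_q (poch (b q) (beta q <= j)%N / poch (b q) (nceil m n (beta q))).

Let num_poly (k j : nat) : {poly K} :=
  \prod_i pochp (a i) (k + (alpha i <= j)%N).

Let num_const_neq0 j : num_const j != 0.
Proof. by apply/prodf_neq0 => i _; rewrite invr_neq0 // poch_neq0. Qed.

Let den_const_neq0 n j : den_const n j != 0.
Proof. by apply/prodf_neq0 => q _; rewrite mulf_neq0 ?invr_neq0 // poch_neq0. Qed.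

Let num_factor k j l :
  \prod_i (poch (a i + (alpha i <= j)%N%:R) (k + l) / poch (a i) l) =
  num_const j * (num_poly k j).[l%:R].
Proof.
rewrite /num_poly horner_prod -big_split; apply: eq_bigr => i _.
exact: poch_ratio_num.
Qed.

Let sum_thresholds k j : (j <= m)%N ->
  (\sum_(t < m) (k + (t.+1 <= j)) = m * k + j)%N.
Proof.
by move=> jm; rewrite big_split /= sum_nat_const card_ord sum_leq_ord (minn_idPr jm).
Qed.

Let leq_num_degree k j : (j <= m)%N ->
  (\sum_i (k + (alpha i <= j)) <= m * k + j)%N.
Proof.
by move=> jm; rewrite -sum_thresholds // (leq_sum_inj m alpha (fun t => k + (t <= j))%N).
Qed.

Let size_num_poly k j : size (num_poly k j) = (\sum_i (k + (alpha i <= j))).+1.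
Proof. exact: size_prod_pochp. Qed.

Let num_poly_monic k j : num_poly k j \is monic.
Proof. by apply: monic_prod => i _; apply: pochp_monic. Qed.

Lemma moment_sum_eq0 (n k j : nat) :
  (j < m)%N -> (m * k + j < n)%N -> moment_sum n k j = 0.
Proof.
move=> jm lt_n.
have m0 : (0 < m)%N by lia.
have le_c t : (1 <= t <= m)%N -> (k + (t <= j) <= nceil m n t)%N.
  by move=> t_range; apply: leq_nceil.
pose den_poly : {poly K} := \prod_q pochp (b q + (k + (beta q <= j)%N)%:R)
  (nceil m n (beta q) - (k + (beta q <= j))).
have den_monic : den_poly \is monic.
  by apply: monic_prod => q _; apply: pochp_monic.
have den_size : (size den_poly <= n - (m * k + j))%N.
  rewrite size_prod_pochp.
  have le1 := leq_sum_inj m beta (fun t => nceil m n t - (k + (t <= j)))%N beta_inj beta_range.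
  (* By [le_c] no subtraction truncates, so the sum splits. Hermite's identity yields [n.-1], and
     this loss of one keeps the total degree below [n]. *)
  have E : (\sum_(t < m) (nceil m n t.+1 - (k + (t.+1 <= j))) = n.-1 - (m * k + j))%N.
    rewrite sumnB => [|t _]; last by rewrite le_c /=.
    by rewrite sum_divn_shift_rev // sum_thresholds // ltnW.
  move: le1; rewrite E; lia.
have size_F : (size (num_poly k j * den_poly)%R <= n)%N.
  rewrite size_Mmonic ?monic_neq0 //.
  have := leq_num_degree k j (ltnW jm); rewrite size_num_poly; lia.
transitivity (num_const j * den_const n j *
  \sum_(l < n.+1) (-1) ^+ l * 'C(n, l)%:R * (num_poly k j * den_poly).[l%:R]).
  rewrite mulr_sumr; apply: eq_bigr => l _; rewrite num_factor.
  have -> : \prod_q (poch (b q + (nceil m n (beta q))%:R) l /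
       poch (b q + (beta q <= j)%N%:R) (k + l)) = den_const n j * den_poly.[l%:R].
    rewrite horner_prod -big_split; apply: eq_bigr => q _.
    by apply: poch_ratio_den => //; apply: le_c.
  by rewrite hornerM; ring.
rewrite finite_difference; last exact: leq_trans size_F _.
by rewrite (nth_default 0 size_F) !mulr0.
Qed.

Hypothesis charK : [pchar K] =i pred0.
(** The comparison, read as 0 or 1, merges the two non-vanishing conditions: the extra 1 is required
    exactly when [beta q < alpha i]. *)
Hypothesis ba_neq0 : forall i q (n : nat),
  ((beta q < alpha i)%N <= n)%N -> b q - a i + n%:R != 0.
Hypothesis full : (r = m /\ forall i, alpha i = i.+1) \/
                  (s = m /\ forall q, beta q = q.+1).

Let fact_neq0 n : n`!%:R != 0 :> K.
Proof. by rewrite ((pcharf0P _).1 charK) -lt0n fact_gt0. Qed.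

Lemma moment_sum_neq0 (n k j : nat) :
  (j < m)%N -> (n = m * k + j)%N -> moment_sum n k j != 0.
Proof.
move=> jm nE; have m0 : (0 < m)%N by lia.
(* At [n = 0] the value of [nceil] is not covered by [nceil_pole]; the sum is then the single term
   1. *)
have [n0|n_gt0] := posnP n.
  have [-> ->] : n = 0%N /\ k = 0%N by nia.
  rewrite /moment_sum big_ord1 expr0 bin0 !mul1r.
  by rewrite !big1 ?mulr1 ?oner_neq0 // => i _; rewrite !poch0 divr1.
have size_F : (size (num_poly k j) <= n.+1)%N.
  by rewrite size_num_poly ltnS nE leq_num_degree // ltnW.
have cE t : (1 <= t <= m)%N ->
    (nceil m n t + (t == pole m j) = k + (t <= j))%N.
  by rewrite nE in n_gt0 *; apply: nceil_pole.
have [/existsP [q0 /eqP q0E]|] := boolP [exists q, beta q == pole m j].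
  (* The factor [x + l] is the one left uncancelled by [q0]; every other denominator ratio is
     constant in [l]. *)
  set x := b q0 + (nceil m n (beta q0))%:R.
  have cq0 := cE _ (beta_range q0); rewrite q0E eqxx addn1 in cq0.
  have x0 i : x + i%:R != 0 by rewrite -addrA -natrD.
  have -> : moment_sum n k j = num_const j * den_const n j *
    \sum_(l < n.+1) (-1) ^+ l * 'C(n, l)%:R * ((num_poly k j).[l%:R] / (x + l%:R)).
    rewrite mulr_sumr; apply: eq_bigr => l _; rewrite num_factor.
    have -> : \prod_q (poch (b q + (nceil m n (beta q))%:R) l /
         poch (b q + (beta q <= j)%N%:R) (k + l)) = den_const n j / (x + l%:R).
      rewrite /den_const (bigD1 q0) //= [in RHS](bigD1 q0) //=.
      rewrite (@poch_ratio_pole _ _ _ k) ?q0E // mulrAC; congr (_ * _ / _).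
        apply: eq_bigr => q nq.
        have nqE : (beta q == pole m j) = false.
          by apply/negbTE; rewrite -q0E (inj_eq beta_inj).
        have := cE _ (beta_range q); rewrite nqE addn0 => cq.
        by rewrite (@poch_ratio_den _ _ _ k) ?cq // subnn horner_pochp poch0 mulr1.
      by rewrite /x q0E.
    by field; apply: x0.
  rewrite finite_difference_pole // !mulf_neq0 ?invr_neq0 ?poch_neq0 //.
  rewrite horner_prod; apply/prodf_neq0 => i _; rewrite horner_pochp.
  apply/prodf_neq0 => t _.
  (* At [-x] the factor of index [t] is [-(b - a + (c - t))] with [c] the ceiling at [q0]; it
     remains to see that [c - t] is large enough for [ba_neq0]. *)
  have : ((beta q0 < alpha i) + t <= nceil m n (beta q0))%N.
    by rewrite q0E in cq0 *; apply: leq_pole cq0 (alpha_range i) (ltn_ord t).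
  move: (nat_of_ord t) => u le_u; rewrite -oppr_eq0.
  have -> : - (a i + - x + u%:R) = b q0 - a i + (nceil m n (beta q0) - u)%:R.
    by rewrite /x natrB; [ring | lia].
  by apply: ba_neq0; lia.
rewrite negb_exists => /forallP no_pole.
have cqE q : nceil m n (beta q) = (k + (beta q <= j))%N.
  by have := cE _ (beta_range q); rewrite (negbTE (no_pole q)) addn0.
have -> : moment_sum n k j = num_const j * den_const n j *
    \sum_(l < n.+1) (-1) ^+ l * 'C(n, l)%:R * (num_poly k j).[l%:R].
  rewrite mulr_sumr; apply: eq_bigr => l _; rewrite num_factor.
  have -> : \prod_q (poch (b q + (nceil m n (beta q))%:R) l /
       poch (b q + (beta q <= j)%N%:R) (k + l)) = den_const n j.
    apply: eq_bigr => q _.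
    by rewrite (@poch_ratio_den _ _ _ k) ?cqE // subnn horner_pochp poch0 mulr1.
  by ring.
have lead : (num_poly k j)`_n = 1.
  (* If [beta] enumerated [[1, m]] it would hit the pole. Hence [alpha] does, and the numerator is
     monic of degree exactly [n]. *)
  case: full => [[rm alphaE]|[sm betaE]]; last first.
    have lt_p : ((pole m j).-1 < s)%N by rewrite /pole; case: (j) jm; lia.
    have /negP [] := no_pole (Ordinal lt_p).
    by rewrite betaE /= /pole; apply/eqP; case: (j) jm; lia.
  have := num_poly_monic k j; rewrite monicE lead_coefE size_num_poly /=.
  suff -> : (\sum_i (k + (alpha i <= j)) = n)%N by move/eqP.
  rewrite nE -(sum_thresholds k j (ltnW jm)) -[in RHS]rm.
  by apply: eq_bigr => i _; rewrite alphaE.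
by rewrite finite_difference // lead mulr1 !mulf_neq0 ?signr_eq0.
Qed.

End UnifiedShifts.

(** * Ceilings and coefficients of the explicit polynomials *)

(** The ceiling of [(n - t) / m] is the floor of [(n - t + m - 1) / m], whose numerator is regrouped
    as [n.-1 + (m - t)] to stay in the naturals. *)
Lemma ceil_nceil (m n t : nat) : (0 < n)%N -> (1 <= t <= m)%N ->
  Num.ceil ((n%:R - t%:R) / m%:R : rat) = (nceil m n t)%:Z.
Proof.
move=> n0 t_range; have m0 : (0 < m)%N by lia.
have m0Q : 0 < m%:R :> rat by rewrite ltr0n.
have le1 := leq_divM (n.-1 + (m - t)) m; rewrite -/(nceil m n t) in le1.
have lt2 := ltn_ceil (n.-1 + (m - t)) m0; rewrite -/(nceil m n t) in lt2.
apply: ceil_def; rewrite ltr_pdivlMr // ler_pdivrMr // intrD -pmulrn.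
rewrite mulrBl mul1r ltrBlDr lerBlDr addrAC ltrBrDr.
rewrite -natrM -!natrD ltr_nat ler_nat; apply/andP; split; lia.
Qed.

Lemma coef_explicit_P {K : fieldType} {r s : nat} (a : 'I_r -> K) (b : 'I_s -> K)
    (lam : 'I_s -> nat) (n l : nat) :
  [pchar K] =i pred0 -> (l <= n)%N ->
  (explicit_P a b lam n)`_l =
  (-1) ^+ n * ((-1) ^+ l * 'C(n, l)%:R) *
  \prod_i (poch (a i) n / poch (a i) l) *
  \prod_j (poch (b_ceil r b lam n j) l / poch (b_ceil r b lam n j) n).
Proof.
move=> charK ln; rewrite /explicit_P coefZ coef_poly ltnS ln /pFq_coef.
rewrite big_cons !big_image /= poch_oppn // natrM !prodf_div.
have l0 : l`!%:R != 0 :> K by rewrite ((pcharf0P _).1 charK) -lt0n fact_gt0.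
move: (\prod_i poch (a i) l)^-1 (\prod_j poch (b_ceil r b lam n j) n)^-1 => x y.
by field.
Qed.

(** Accounts for the denominators in the coefficients of [explicit_P]: division is available in the
    field generated by the [b j]. *)
Lemma in_Qb_prod_pochV {K : fieldType} {s : nat} (b : 'I_s -> K) (c d : 'I_s -> nat) :
  in_Qb b (\prod_j (poch (b j + (c j)%:R) (d j))^-1).
Proof.
move=> S divS Sb.
pose S' : divringClosed K := HB.pack S (GRing.isDivringClosed.Build K S divS).
rewrite -[S]/(S' : {pred K}) in Sb *.
apply: rpred_prod => j _; rewrite rpredV.
by apply: rpred_prod => i _; rewrite !rpredD ?rpred_nat ?Sb.
Qed.

Lemma size_explicit_P {K : fieldType} {r s : nat} (a : 'I_r -> K) (b : 'I_s -> K)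
    (lam : 'I_s -> nat) (n : nat) : (size (explicit_P a b lam n) <= n.+1)%N.
Proof. exact: leq_trans (size_scale_leq _ _) (size_poly _ _). Qed.

(** * Uniqueness of [d]-orthogonal sequences *)

Section Uniqueness.
Variables (R : comNzRingType) (d : nat) (u : 'I_d -> {scalar {poly R}}).
(** Absence of zero divisors is assumed separately because [Qba] is declared only as a commutative
    ring; it is inherited from [K]. *)
Hypothesis mulr_neq0_eq0 : forall x y : R, x * y = 0 -> y != 0 -> x = 0.

Lemma monic_poly_seq_span (P : nat -> {poly R}) (n : nat) (p : {poly R}) :
  monic_poly_seq P -> (size p <= n)%N ->
  exists c : nat -> R, p = \sum_(i < n) c i *: P i.
Proof.
move=> monP; elim: n p => [|n IHn] p sp.
  exists (fun=> 0); rewrite big_ord0; apply/eqP.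
  by rewrite -size_poly_eq0 -leqn0.
have [Pn_monic Pn_size] := monP n.
have sp' : (size (p - p`_n *: P n)%R <= n)%N.
  apply/leq_sizeP => i; rewrite leq_eqVlt => /predU1P[<-|lt_ni].
    move: Pn_monic; rewrite monicE lead_coefE Pn_size /= => /eqP Pnn.
    by rewrite coefB coefZ Pnn mulr1 subrr.
  rewrite coefB coefZ [(P n)`_i]nth_default ?Pn_size // mulr0 subr0.
  by rewrite nth_default // (leq_trans sp).
have [c cE] := IHn _ sp'.
exists (fun i => if i == n then p`_n else c i); rewrite big_ord_recr /= eqxx.
rewrite -[LHS](subrK (p`_n *: P n)) cE; congr (_ + _).
by apply: eq_bigr => i _; rewrite ltn_eqF.
Qed.

(** Expand [Q n - P n] in the [P i] with [i < n]. For [i = d k + j], applying [u j] after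
    multiplication by [x^k] kills the later terms, induction kills the earlier ones, and [c i] times
    a nonzero value remains equal to 0. *)
Lemma d_orthogonal_unique (P Q : nat -> {poly R}) :
  (0 < d)%N -> d_orthogonal u P -> d_orthogonal u Q -> forall n, Q n = P n.
Proof.
move=> d0 [monP orthP] [monQ orthQ] n.
have sQP : (size (Q n - P n)%R <= n)%N.
  apply/leq_sizeP => i; rewrite leq_eqVlt => /predU1P[<-|lt_ni].
    have [] := monP n; have [] := monQ n; rewrite !monicE !lead_coefE.
    by move=> Q1 sQ P1 sP; move: Q1 P1; rewrite sQ sP coefB /= => /eqP-> /eqP->; rewrite subrr.
  by rewrite coefB !nth_default ?subr0 // ?(monP n).2 ?(monQ n).2.
have [c cE] := monic_poly_seq_span P n _ monP sQP.
suff c0 i : (i < n)%N -> c i = 0.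
  by apply/eqP; rewrite -subr_eq0 cE big1 // => i _; rewrite c0 // scale0r.
elim/ltn_ind: i => i IHi lt_in.
pose j := Ordinal (ltn_pmod i d0).
have iE : i = (d * (i %/ d) + j)%N by rewrite mulnC -divn_eq.
have : u j ('X^(i %/ d) * (Q n - P n)) = 0.
  rewrite mulrBr linearB /= (orthQ _ _ _).2 ?(orthP _ _ _).2 ?subrr // -iE; lia.
rewrite cE mulr_sumr linear_sum /= (bigD1 (Ordinal lt_in)) //= big1 => [|i' ni'].
  rewrite addr0 -scalerAr linearZ /= => /mulr_neq0_eq0; apply.
  by apply: (orthP _ _ _).1.
rewrite -scalerAr linearZ /=; have [lt_i'|] := ltnP i' i.
  by rewrite IHi ?mul0r.
rewrite leq_eqVlt => /predU1P[ii'|lt_ii'].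
  by case/eqP: ni'; apply: val_inj.
by rewrite (orthP _ _ _).2 ?mulr0 // -iE addn1.
Qed.

End Uniqueness.

(** * Unifying the two cases and descending from [K] to [Qba] *)

Theorem theorem6p1 (K : fieldType) (charK : [pchar K] =i pred0)
  (r s : nat) (m_ge1 : (1 <= maxn r s)%N)
  (lam : 'I_s -> nat) (sig : 'I_r -> nat)
  (lam_range : (s <= r)%N -> forall j, (1 <= lam j <= r)%N)
  (lam_incr : (s <= r)%N -> forall j j' : 'I_s, (j < j')%N -> (lam j < lam j')%N)
  (sig_range : (r <= s)%N -> forall i, (1 <= sig i <= s)%N)
  (sig_incr : (r <= s)%N -> forall i i' : 'I_r, (i < i')%N -> (sig i < sig i')%N)
  (a : 'I_r -> K) (b : 'I_s -> K)
  (a_neq0 : forall i (n : nat), a i + n%:R != 0)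
  (b_neq0 : forall j (n : nat), b j + n%:R != 0)
  (ba_lam : (s <= r)%N -> forall (i : 'I_r) (j : 'I_s) (n : nat),
     ((i.+1 <= lam j)%N -> b j - a i + n%:R != 0) /\
     ((i.+1 >= lam j + 1)%N -> b j - a i + 1 + n%:R != 0))
  (ba_sig : (r <= s)%N -> forall (i : 'I_r) (j : 'I_s) (n : nat),
     ((sig i <= j.+1)%N -> b j - a i + n%:R != 0) /\
     ((sig i >= j.+1 + 1)%N -> b j - a i + 1 + n%:R != 0))
  (v : 'I_(maxn r s) -> {scalar {poly Qba a b}})
  (v_moments : forall (k : 'I_(maxn r s)) (n : nat),
     val (v k 'X^n) = moment a b lam sig k n) :
  exists P : nat -> {poly Qba a b},
    [/\ d_orthogonal v P,
        (forall Q : nat -> {poly Qba a b}, d_orthogonal v Q -> forall n, Q n = P n)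
      & (forall n, map_poly val (P n) = explicit_P a b lam n)].
Proof.
pose m := maxn r s.
pose alpha (i : 'I_r) := if (s <= r)%N then i.+1 else sig i.
pose beta (j : 'I_s) := if (s <= r)%N then lam j else j.+1.
have incr_inj (p : nat) (f : 'I_p -> nat) :
    (forall i i' : 'I_p, (i < i')%N -> (f i < f i')%N) -> injective f.
  move=> f_incr i i' eq_f; apply: val_inj => /=.
  by case: (ltngtP i i') => // /f_incr; rewrite eq_f ltnn.
have alpha_inj : injective alpha.
  rewrite /alpha; case: (leqP s r) => [_|/ltnW rs]; last exact/incr_inj/sig_incr.
  by move=> i i' [] /val_inj.
have beta_inj : injective beta.
  rewrite /beta; case: (leqP s r) => [sr|_]; first exact/incr_inj/lam_incr.
  by move=> i i' [] /val_inj.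
have alpha_range i : (1 <= alpha i <= m)%N.
  rewrite /alpha /m; case: (leqP s r) => [sr|/ltnW rs]; first by have := ltn_ord i; lia.
  by have := sig_range rs i; lia.
have beta_range j : (1 <= beta j <= m)%N.
  rewrite /beta /m; case: (leqP s r) => [sr|/ltnW rs]; last by have := ltn_ord j; lia.
  by have := lam_range sr j; lia.
have ba_neq0 i j (n : nat) : ((beta j < alpha i)%N <= n)%N -> b j - a i + n%:R != 0.
  have key (ba : forall p : nat,
      ((alpha i <= beta j)%N -> b j - a i + p%:R != 0) /\
      ((alpha i >= beta j + 1)%N -> b j - a i + 1 + p%:R != 0)) :
      ((beta j < alpha i)%N <= n)%N -> b j - a i + n%:R != 0.
    case: leqP => [le_ab _|lt_ba]; first by apply: (ba n).1.
    case: n => // n _; rewrite mulrS addrA; apply: (ba n).2; lia.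
  apply: key => p; rewrite /alpha /beta; case: (leqP s r) => [sr|/ltnW rs].
    exact: ba_lam.
  exact: ba_sig.
have full : (r = m /\ forall i, alpha i = i.+1) \/ (s = m /\ forall j, beta j = j.+1).
  by rewrite /alpha /beta /m; case: (leqP s r) => le_rs; [left | right]; split => //; lia.
have momentE k n : moment a b lam sig k n =
    \prod_i poch (a i + (alpha i <= k)%N%:R) n /
    \prod_j poch (b j + (beta j <= k)%N%:R) n.
  rewrite /moment; congr (_ / _); apply: eq_bigr => i _; congr poch.
    by rewrite /a_shift /alpha; do 2!case: ifP => _; rewrite ?addr0.
  by rewrite /b_shift /beta; do 2!case: ifP => _; rewrite ?addr0.
pose B n j := b j + (nceil m n (beta j))%:R.
have B_neq0 n j p : B n j + p%:R != 0 by rewrite -addrA -natrD.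
(* At [n = 0] the two ceilings may differ, but then [l = 0] and both products are empty. *)
have poch_b_ceil n j l : (l <= n)%N -> poch (b_ceil r b lam n j) l = poch (B n j) l.
  case: n => [|n] ln; first by move: ln; rewrite leqn0 => /eqP->; rewrite !poch0.
  congr poch; rewrite /b_ceil /B /m /beta; move: (beta_range j); rewrite /beta /m.
  by case: (leqP s r) => le_rs br; rewrite ceil_nceil.
have coefE n l : (l <= n)%N -> (explicit_P a b lam n)`_l =
    (-1) ^+ n * ((-1) ^+ l * 'C(n, l)%:R) * \prod_i (poch (a i) n / poch (a i) l) *
    \prod_j (poch (B n j) l / poch (B n j) n).
  move=> ln; rewrite coef_explicit_P //; congr (_ * _).
  by apply: eq_bigr => j _; rewrite !poch_b_ceil.
have explicit_in n l : (explicit_P a b lam n)`_l \in Qba_pred a b.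
  have [ln|ln] := leqP l n; last first.
    by rewrite nth_default ?rpred0 // (leq_trans (size_explicit_P _ _ _ _)).
  rewrite coefE // !rpredM ?rpred_sign ?rpred_nat //.
    (* The ratio [(a)_n / (a)_l] is [(a + l)_(n-l)], so no inverse of an [a i] occurs. *)
    apply: rpred_prod => i _; rewrite -(subnKC ln) pochD mulrAC mulfV ?poch_neq0 // mul1r.
    apply: rpred_prod => p _; rewrite !rpredD ?rpred_nat //.
    by apply/asboolP => S _ _; apply.
  have -> : \prod_j (poch (B n j) l / poch (B n j) n) =
      \prod_j (poch (b j + (nceil m n (beta j) + l)%:R) (n - l))^-1.
    apply: eq_bigr => j _; rewrite natrD addrA -/(B n j).
    have -> : poch (B n j) n = poch (B n j) l * poch (B n j + l%:R) (n - l).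
      by rewrite -pochD subnKC.
    by rewrite invfM mulrA mulfV ?mul1r ?poch_neq0.
  by apply/asboolP => S _ Sb _; apply: Sb; apply: in_Qb_prod_pochV.
have val_eq0 (x : Qba a b) : (val x == 0) = (x == 0) by rewrite -(inj_eq val_inj).
(* By [explicit_in] the default value 0 of [insubd] is never taken. *)
pose P n : {poly Qba a b} := \poly_(l < n.+1) insubd 0 (explicit_P a b lam n)`_l.
have coefP n l : val (P n)`_l = (explicit_P a b lam n)`_l.
  rewrite coef_poly; case: ltnP => ln; first by rewrite val_insubd explicit_in.
  by rewrite nth_default // (leq_trans (size_explicit_P _ _ _ _)).
have monP : monic_poly_seq P.
  move=> n; have Pnn : (P n)`_n = 1.
    apply: val_inj; rewrite coefP coefE // binn mulr1 -expr2 sqrr_sign mul1r.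
    rewrite !big1 ?mulr1 // => i _; rewrite mulfV ?poch_neq0 //.
  have sPn : size (P n) = n.+1.
    apply/eqP; rewrite eqn_leq size_poly; apply: contraT; rewrite -leqNgt => sP.
    by move: (oner_neq0 (Qba a b)); rewrite -Pnn nth_default // eqxx.
  by rewrite monicE lead_coefE sPn Pnn.
have vP (j : 'I_m) k n : val (v j ('X^k * P n)) =
    (-1) ^+ n * (\prod_i poch (a i) n / \prod_q poch (B n q) n) *
    moment_sum K r s m alpha beta a b n k j.
  (* Expanding [P n] reduces the value to moments; pulling out the factor independent of [l] leaves
     [moment_sum]. *)
  rewrite -[P n]coefK (monP n).2 poly_def [X in v j X]mulr_sumr linear_sum.
  rewrite raddf_sum mulr_sumr.
  apply: eq_bigr => l _; rewrite -scalerAr.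
  have -> c p : v j (c *: p) = c * v j p by exact: linearZ.
  rewrite -exprD; transitivity (val (P n)`_l * val (v j 'X^(k + l))).
    exact: rmorphM.
  rewrite v_moments coefP.
  by rewrite coefE -1?ltnS // momentE !prodf_div -/(B n _); ring.
have orthP : d_orthogonal v P.
  split=> // j k n; split=> [nE|lt_n]; last first.
    by apply: val_inj; rewrite vP moment_sum_eq0 ?mulr0 // /m -addn1.
  rewrite -val_eq0 vP !mulf_neq0 ?signr_eq0 ?invr_neq0 //.
  - by apply/prodf_neq0 => i _; rewrite poch_neq0.
  - by apply/prodf_neq0 => i _; rewrite poch_neq0.
  - exact: moment_sum_neq0.
exists P; split=> // [Q orthQ|n].
- apply: (d_orthogonal_unique _ _ v) => // x y xy0 y0.
  have : val x * val y = 0 := congr1 val xy0.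
  by move/eqP; rewrite mulf_eq0 !val_eq0 (negbTE y0) orbF => /eqP.
- by apply/polyP => l; rewrite coef_map /= coefP.
Qed.
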